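(* Let $p$ be an odd prime, $k,n\ge1$, $G=\mathbb{F}_p^n$, and let $J\in\mathbb{F}_p^{k\times k}$ be such that $J$, $I-J$, $I+J$ are invertible and no two eigenvalues of $J$ (over $\overline{\mathbb{F}}_p$) are negatives of each other. Let $\mathfrak{B}$ be a $k$-symmetrized quadratic factor of complexity $(d_1,d_2,d_3)$ and rank $r$. Then for every $a=((a_{1,i})_{i\in[d_1]},(a_{2,i})_{i\in[d_2]},(a_{3,i})_{i\in[d_3]})$ with $a_{1,i}\in\Psi_J$, $a_{2,i}\in\Lambda_J^\perp$, $a_{3,i}\in\Lambda_J'^\perp$, the probability, over independent uniform $X,D\in\mathbb{F}_p^{k\times n}$, that for every $j\in\{1,2,3\}$ and every relevant $i$ \[\big(\mathsf{B}_{j,i}(X),\mathsf{B}_{j,i}(X+D),\mathsf{B}_{j,i}(X+JD),\mathsf{B}_{j,i}(X+(I+J)D)\big)=a_{j,i}\] equals \[p^{-d_1\dim(\Psi_J)-d_2\dim(\Lambda_J^\perp)-d_3\dim(\Lambda_J'^\perp)}\Big(1+O\big(p^{-r/2+2kd_1+(2\binom{k+1}{2}+k^2)d_2+(2\binom{k}{2}+k^2)d_3}\big)\Big).\]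
   Context: $I$ is the $k\times k$ identity; $\mathcal{S}_k$, $\mathcal{S}_k'$ are the symmetric, skew-symmetric $k\times k$ matrices over $\mathbb{F}_p$. A $k$-symmetrized quadratic factor $\mathfrak{B}$ is given by vectors $r_1,\ldots,r_{d_1}\in\mathbb{F}_p^n$, symmetric $n\times n$ matrices $M_1,\ldots,M_{d_2}$ and skew-symmetric $n\times n$ matrices $N_1,\ldots,N_{d_3}$ over $\mathbb{F}_p$; it has rank at least $r$ if the $r_i$ are linearly independent and every nontrivial combination $\sum a_iM_i+\sum b_jN_j$ has rank at least $r$. For $X\in\mathbb{F}_p^{k\times n}$: $\mathsf{B}_{1,i}(X)=Xr_i\in\mathbb{F}_p^k$, $\mathsf{B}_{2,i}(X)=XM_iX^\intercal\in\mathcal{S}_k$, $\mathsf{B}_{3,i}(X)=XN_iX^\intercal\in\mathcal{S}_k'$; $JD$ is a matrix product. Define $\Xi_J=\{A\in\mathbb{F}_p^{k\times k}:(JA)^\intercal=JA\}$, $\Lambda_J=\{(-A,-A(I+J)(I-J)^{-1},A(I+J)(I-J)^{-1},A): A^\intercal=A,\ A\in\Xi_J\}$, $\Lambda_J'=\{(-A,-A(I+J)(I-J)^{-1},A(I+J)(I-J)^{-1},A): A^\intercal=-A,\ A\in\Xi_J\}$, $\Psi_J=\{(x_1,x_2,x_3,x_4)\in(\mathbb{F}_p^k)^4: x_1-x_2-x_3+x_4=0,\ x_4-x_2=J(x_2-x_1)\}$. Equip $(\mathbb{F}_p^{k\times k})^4$ with the bilinear form $\langle(X_1,\ldots,X_4),(Y_1,\ldots,Y_4)\rangle=\sum_{i=1}^4\operatorname{tr}(X_i^\intercal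 Y_i)$. Then $\Lambda_J^\perp$ denotes $\{v\in\mathcal{S}_k^4:\langle v,w\rangle=0\ \forall w\in\Lambda_J\}$ and $\Lambda_J'^\perp$ denotes $\{v\in(\mathcal{S}_k')^4:\langle v,w\rangle=0\ \forall w\in\Lambda_J'\}$; $\dim$ denotes $\mathbb{F}_p$-dimension.
   Formalization: Ξ_J is taken as {A : JᵀA = AJ} instead of {A : (JA)ᵀ = JA}; with the printed Ξ_J the claim fails, e.g. p=5, k=2, J=2I, one skew-symmetric matrix of large rank, a=(E,0,0,0) with E≠0 skew, where the probability is 0. *)

(* Defs.v *)
From HB Require Import structures.
From mathcomp Require Import all_boot all_order all_algebra all_field.
From mathcomp Require Import reals exp ring.

Set Implicit Arguments.
Unset Strict Implicit.
Unset Printing Implicit Defensive.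

Import Order.TTheory GRing.Theory Num.Theory.
Local Open Scope ring_scope.

(* The MathComp closure theorem is opaque, so [Fbar F] is only known to be an
   algebraically closed algebraic extension of F, embedded by [toFbar F]. *)
Definition Fbar (F : finFieldType) : closedFieldType :=
  projT1 (countable_algebraic_closure F).

Definition toFbar (F : finFieldType) : {rmorphism F -> Fbar F} :=
  sval (projT2 (countable_algebraic_closure F)).

(* The case l = m is included: in odd characteristic it excludes only the
   eigenvalue 0. *)
Definition no_opposite_eigenvalues (F : finFieldType) (k : nat)
    (J : 'M[F]_k) : Prop :=
  forall l m : Fbar F,
    eigenvalue (map_mx (toFbar F) J) l -> eigenvalue (map_mx (toFbar F) J) m ->
    l != - m.

Notation quad T := (T * T * T * T)%type.

(* The dimension of the span of S; every S it is used on is a subspace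
   (lemmas [span_Psi], [span_LambdaPerp], [span_LambdaPerp']). *)
Notation fdim S := (\dim <<enum S>>%VS).

Section Relations.
Variables (F : finFieldType) (k : nat).
Implicit Types (J A : 'M[F]_k) (v w : quad 'M[F]_k).

(* Symmetric A satisfy it iff (A J)^T = A J, skew-symmetric A iff
   (A J)^T = - A J.  It is what makes A (I + J) (I - J)^-1 symmetric, resp.
   skew-symmetric, as soon as A is, and what makes the quadruples of [Lambda]
   and [Lambda'] orthogonal to all values of the quadratic pattern.  The
   condition (J A)^T = J A found in print does neither: for J = a I it holds
   for no skew-symmetric A <> 0, although all skew-symmetric A are needed. *)
Definition Xi J : {set 'M[F]_k} := [set A | J^T *m A == A *m J].

Definition relation_of J A : quad 'M[F]_k :=
  let K := (1%:M + J) *m invmx (1%:M - J) in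
  (- A, - (A *m K), A *m K, A).

Definition Lambda J : {set quad 'M[F]_k} :=
  [set relation_of J A | A in [set A in Xi J | A^T == A]].

Definition Lambda' J : {set quad 'M[F]_k} :=
  [set relation_of J A | A in [set A in Xi J | A^T == - A]].

Definition Psi J : {set quad 'cV[F]_k} :=
  [set x | let: (x1, x2, x3, x4) := x in
           (x1 - x2 - x3 + x4 == 0) && (x4 - x2 == J *m (x2 - x1))].

Definition pairing v w : F :=
  let: (x1, x2, x3, x4) := v in
  let: (y1, y2, y3, y4) := w in
  \tr (x1^T *m y1) + \tr (x2^T *m y2) + \tr (x3^T *m y3) + \tr (x4^T *m y4).

Definition all4 (P : pred 'M[F]_k) v : bool :=
  let: (x1, x2, x3, x4) := v in [&& P x1, P x2, P x3 & P x4].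

Definition LambdaPerp J : {set quad 'M[F]_k} :=
  [set v | all4 (fun A => A^T == A) v
           && [forall w in Lambda J, pairing v w == 0]].

Definition LambdaPerp' J : {set quad 'M[F]_k} :=
  [set v | all4 (fun A => A^T == - A) v
           && [forall w in Lambda' J, pairing v w == 0]].

Lemma span_closed (V : vectType F) (e : seq V) :
  0 \in e -> (forall c x y, x \in e -> y \in e -> c *: x + y \in e) ->
  <<e>>%VS =i e.
Proof.
move=> e0 elin x; apply/idP/idP => [|xe]; last exact: memv_span.
have aux (s : seq V) : {subset s <= e} -> {subset <<s>>%VS <= e}.
  elim: s => [|y s IHs] se z; first by rewrite span_nil memv0 => /eqP->.
  rewrite span_cons => /memv_addP[u /vlineP[c ->] [t ts ->]].
  apply: elin; first by apply: se; rewrite mem_head.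
  by apply: IHs ts => w ws; apply: se; rewrite inE ws orbT.
exact: aux.
Qed.

Lemma span_Psi J : <<enum (Psi J)>>%VS =i Psi J.
Proof.
move=> x; rewrite span_closed => [|{x}|{x}c x y]; rewrite ?mem_enum //.
  by rewrite inE /= !subr0 addr0 mulmx0 !eqxx.
case: x y => [[[x1 x2] x3] x4] [[[y1 y2] y3] y4]; rewrite !inE /=.
move=> /andP[/eqP x0 /eqP xJ] /andP[/eqP y0 /eqP yJ]; apply/andP; split.
  have -> : c *: x1 + y1 - (c *: x2 + y2) - (c *: x3 + y3) + (c *: x4 + y4)
    = c *: (x1 - x2 - x3 + x4) + (y1 - y2 - y3 + y4).
    by apply/matrixP=> i j; rewrite !mxE; ring.
  by rewrite x0 y0 scaler0 addr0.
have -> : c *: x4 + y4 - (c *: x2 + y2) = c *: (x4 - x2) + (y4 - y2).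
  by apply/matrixP=> i j; rewrite !mxE; ring.
have -> : c *: x2 + y2 - (c *: x1 + y1) = c *: (x2 - x1) + (y2 - y1).
  by apply/matrixP=> i j; rewrite !mxE; ring.
by rewrite mulmxDr -scalemxAr xJ yJ.
Qed.

Lemma pairing_lin c v w u :
  pairing (c *: v + w) u = c * pairing v u + pairing w u.
Proof.
have tr_lin (a b d : 'M[F]_k) :
    \tr ((c *: a + b)^T *m d) = c * \tr (a^T *m d) + \tr (b^T *m d).
  by rewrite linearD linearZ /= mulmxDl -scalemxAl mxtraceD mxtraceZ.
case: v w u => [[[v1 v2] v3] v4] [[[w1 w2] w3] w4] [[[u1 u2] u3] u4].
by rewrite /pairing /= !tr_lin; ring.
Qed.

Lemma span_perp (P : pred 'M[F]_k) (L : {set quad 'M[F]_k}) :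
  P 0 -> (forall c A B, P A -> P B -> P (c *: A + B)) ->
  let S := [set v | all4 P v && [forall w in L, pairing v w == 0]] in
  <<enum S>>%VS =i S.
Proof.
move=> P0 Plin S x; rewrite span_closed => [|{x}|{x}c x y]; rewrite ?mem_enum //.
  rewrite inE /= !P0 /=; apply/forall_inP => -[[[w1 w2] w3] w4] _ /=.
  by rewrite !trmx0 !mul0mx !mxtrace0 !addr0.
rewrite !inE => /andP[Px /forall_inP xL] /andP[Py /forall_inP yL].
apply/andP; split; last first.
  apply/forall_inP => w wL; rewrite pairing_lin.
  by rewrite (eqP (xL w wL)) (eqP (yL w wL)) mulr0 addr0.
case: x y Px Py {xL yL} => [[[x1 x2] x3] x4] [[[y1 y2] y3] y4] /=.
by move=> /and4P[? ? ? ?] /and4P[? ? ? ?]; rewrite !Plin.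
Qed.

Lemma span_LambdaPerp J : <<enum (LambdaPerp J)>>%VS =i LambdaPerp J.
Proof.
apply: span_perp => [|c A B /eqP AE /eqP BE]; first by rewrite trmx0.
by rewrite linearD linearZ /= AE BE.
Qed.

Lemma span_LambdaPerp' J : <<enum (LambdaPerp' J)>>%VS =i LambdaPerp' J.
Proof.
apply: span_perp => [|c A B /eqP AE /eqP BE]; first by rewrite trmx0 oppr0.
by rewrite linearD linearZ /= AE BE scalerN opprD.
Qed.

End Relations.

Record sym_quad_factor (F : finFieldType) (n d1 d2 d3 : nat) := SymQuadFactor {
  lin_part : 'I_d1 -> 'cV[F]_n;
  sym_part : 'I_d2 -> 'M[F]_n;
  skew_part : 'I_d3 -> 'M[F]_n;
  sym_partP : forall i, (sym_part i)^T = sym_part i;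
  skew_partP : forall i, (skew_part i)^T = - skew_part i
}.

Section Factor.
Variables (F : finFieldType) (n d1 d2 d3 : nat).
Variable B : sym_quad_factor F n d1 d2 d3.

Definition has_rank_ge (r : nat) : Prop :=
  free [seq lin_part B i | i <- enum 'I_d1] /\
  forall (a : 'I_d2 -> F) (b : 'I_d3 -> F),
    (exists i, a i != 0) \/ (exists j, b j != 0) ->
    (r <= \rank (\sum_i a i *: sym_part B i
                 + \sum_j b j *: skew_part B j)%R)%N.

Variable k : nat.

Definition B1 (i : 'I_d1) (X : 'M[F]_(k, n)) : 'cV[F]_k := X *m lin_part B i.

Definition B2 (i : 'I_d2) (X : 'M[F]_(k, n)) : 'M[F]_k :=
  X *m sym_part B i *m X^T.

Definition B3 (i : 'I_d3) (X : 'M[F]_(k, n)) : 'M[F]_k :=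
  X *m skew_part B i *m X^T.

End Factor.

Definition on_pattern (F : finFieldType) (k n : nat) (T : Type) (J : 'M[F]_k)
    (f : 'M[F]_(k, n) -> T) (X D : 'M[F]_(k, n)) : quad T :=
  (f X, f (X + D), f (X + J *m D), f (X + (1%:M + J) *m D)).

Definition unif_prob (R : realType) (T : finType) (E : pred T) : R :=
  #|E|%:R / #|T|%:R.

(* Main.v *)
Require Import Defs.
From HB Require Import structures.
From mathcomp Require Import all_boot all_order all_algebra all_field.
From mathcomp Require Import mxabelem.
From mathcomp Require Import reals exp.
From mathcomp Require Import ring.

Set Implicit Arguments.
Unset Strict Implicit.
Unset Printing Implicit Defensive.

Import Order.TTheory GRing.Theory Num.Theory.
Local Open Scope ring_scope.

(* Expand the indicator of the event in additive characters.  Writing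
   Z = (X; D), the phase attached to a tuple of coefficients is a linear form
   in Z plus the sums of tr (C_i^T Z M_i Z^T) and tr (C'_j^T Z N_j Z^T), where
   C is obtained from a coefficient quadruple by pulling it back to 2k x 2k
   matrices.  If C_i + C_i^T or C'_j - C'_j^T is nonzero for some index, one of
   its entries exhibits a nontrivial combination of the M_i and N_j as a block
   of the polar form, so Weyl differencing bounds the sum by p^(-r/2) times its
   trivial bound.  If they all vanish, the phase is linear, and its sum is 0
   unless the phase is 0 by independence of the r_i.

   The remaining coefficients form the orthogonal of Psi, LambdaPerp and
   LambdaPerp' and give the main term.  For the quadratic part this says that
   a quadruple with zero pull-back is a relation (-A, -AK, AK, A) with
   J^T A = A J; this reduces to the uniqueness of the solution of the Sylvester
   equation J^T Y + Y J = 0, which is what the eigenvalue condition is for.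
   The dimension of LambdaPerp is at most that of the symmetric matrices of
   size 2k, namely 2 C(k+1,2) + k^2, and likewise in the skew case, whence the
   exponent of the error term. *)

(** Registered so that products and finite functions of finite groups are again of type
    [finZmodType], as [atoms] requires. *)
HB.instance Definition _ (U V : finZmodType) := GRing.Zmodule.on (U * V)%type.
HB.instance Definition _ (I : finType) (V : finZmodType) :=
  GRing.Zmodule.on {ffun I -> V}.

(** * Additive character sums *)

Section CharacterSums.
Variable F : finZmodType.

(** The trivial kernel ensures that any nonzero additive map into F composes to a nontrivial
    character. Over ['F_p] it amounts to nontriviality. *)
Definition faithful_char (chi : F -> algC) : Prop :=
  [/\ {morph chi : x y / x + y >-> x * y}, forall x, chi x = 1 -> x = 0
    & forall x, `|chi x| = 1].

Variable chi : F -> algC.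
Hypothesis chiP : faithful_char chi.

Let chiD : {morph chi : x y / x + y >-> x * y}. Proof. by case: chiP. Qed.
Let chi_eq1 x : chi x = 1 -> x = 0. Proof. by case: chiP => _ + _; apply. Qed.
Let chi_norm x : `|chi x| = 1. Proof. by case: chiP. Qed.

Lemma char_neq0 x : chi x != 0.
Proof. by rewrite -normr_eq0 chi_norm oner_eq0. Qed.

Lemma char0 : chi 0 = 1.
Proof. by apply: (mulfI (char_neq0 0)); rewrite -chiD addr0 mulr1. Qed.

Lemma charB x y : chi (x - y) = chi x * (chi y)^*.
Proof.
apply: (mulIf (char_neq0 y)); rewrite -chiD subrK -mulrA [_^* * _]mulrC.
by rewrite -normCK chi_norm expr1n mulr1.
Qed.

(** If g u <> 0 for some u in T, translation by u multiplies the sum by chi (g u) <> 1, which forces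
    it to be 0. *)
Lemma char_sum_subgroup (V : finZmodType) (T : {set V}) (g : V -> F) :
  0 \in T -> {in T &, forall x y, x - y \in T} ->
  {morph g : x y / x + y >-> x + y} ->
  \sum_(v in T) chi (g v) = if [forall v in T, g v == 0] then #|T|%:R else 0.
Proof.
move=> T0 TB gD; case: ifPn => [/forall_inP g0|].
  by rewrite (eq_bigr (fun=> 1)) ?sumr_const // => v /g0/eqP->; rewrite char0.
rewrite negb_forall_in => /exists_inP[u uT gu].
have TN x : x \in T -> - x \in T by move=> xT; rewrite -sub0r TB.
have shift : \sum_(v in T) chi (g v) = chi (g u) * \sum_(v in T) chi (g v).
  rewrite {1}(reindex_inj (addrI u)) big_distrr /=.
  apply: eq_big => [v|v _]; last by rewrite gD chiD.
  apply/idP/idP => vT; first by rewrite -(addKr u v) addrC TB.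
  by rewrite -[v]opprK TB // TN.
have /eqP : (1 - chi (g u)) * \sum_(v in T) chi (g v) = 0.
  by rewrite mulrBl mul1r -shift subrr.
rewrite mulf_eq0 subr_eq0 => /orP[/eqP/esym/chi_eq1 g0|/eqP//].
by rewrite g0 eqxx in gu.
Qed.

Lemma char_sum_additive (V : finZmodType) (g : V -> F) :
  {morph g : x y / x + y >-> x + y} ->
  \sum_v chi (g v) = if [forall v, g v == 0] then #|V|%:R else 0.
Proof.
move=> gD; have := @char_sum_subgroup V setT g.
rewrite (eq_bigl predT) => [->|v]; rewrite ?inE // ?cardsT.
  by congr (if _ then _ else _); apply: eq_forallb => v; rewrite inE.
by move=> x y _ _; rewrite inE.
Qed.

(** Weyl differencing: the square is the sum over w and shifts h of chi (f (w + h) - f w). For fixed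
    h the sum over w is a character sum, nonzero only when [beta h] vanishes. *)
Lemma norm_sqr_char_sum (V : finZmodType) (f : V -> F) (beta : V -> V -> F)
    (gamma : V -> F) :
  (forall h, {morph beta h : x y / x + y >-> x + y}) ->
  (forall h w, f (w + h) - f w = beta h w + gamma h) ->
  `|\sum_v chi (f v)| ^+ 2
    <= #|V|%:R * #|[set h | [forall w, beta h w == 0]]|%:R.
Proof.
move=> betaD fE.
have E : `|\sum_v chi (f v)| ^+ 2
    = \sum_h chi (gamma h) * \sum_w chi (beta h w).
  rewrite normCK rmorph_sum mulr_sumr.
  rewrite (eq_bigr (fun w => \sum_h chi (f (w + h) - f w))) => [|w _].
    rewrite exchange_big; apply: eq_bigr => h _; rewrite big_distrr.
    by apply: eq_bigr => w _; rewrite fE chiD mulrC.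
  rewrite mulr_suml (reindex_inj (addrI w)).
  by apply: eq_bigr => h _; rewrite charB.
rewrite -[leLHS]ger0_norm ?exprn_ge0 // E.
apply: le_trans (ler_norm_sum _ _ _) _.
rewrite mulr_natr -sumr_const [X in _ <= X]big_mkcond ler_sum // => h _.
rewrite normrM chi_norm mul1r char_sum_additive // inE.
by case: ifP; rewrite ?normr0 // normr_nat.
Qed.

Section Pairing.
Variables (W : finZmodType) (b : W -> W -> F).
Hypothesis bDl : forall w, {morph b^~ w : x y / x + y >-> x + y}.
Hypothesis bDr : forall c, {morph b c : x y / x + y >-> x + y}.
Hypothesis b_ndl : forall c, (forall w, b c w = 0) -> c = 0.
Hypothesis b_ndr : forall w, (forall c, b c w = 0) -> w = 0.

Let b0l w : b 0 w = 0.
Proof. by apply: (addrI (b 0 w)); rewrite -bDl !addr0. Qed.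

Let b0r c : b c 0 = 0.
Proof. by apply: (addrI (b c 0)); rewrite -bDr !addr0. Qed.

(** Double counting of the sum of chi (b c w) over c in T and all w: summing over c first leaves the
    orthogonal of T, summing over w first leaves c = 0. *)
Lemma card_orthogonal (T : {set W}) :
  0 \in T -> {in T &, forall x y, x - y \in T} ->
  (#|T| * #|[set w | [forall c in T, b c w == 0%R]]| = #|W|)%N.
Proof.
move=> T0 TB; apply/eqP; rewrite -(eqr_nat algC) natrM; apply/eqP.
have : \sum_w \sum_(c in T) chi (b c w) = \sum_(c in T) \sum_w chi (b c w).
  exact: exchange_big.
rewrite (eq_bigr (fun w => if [forall c in T, b c w == 0] then #|T|%:R else 0));
  last by move=> w _; rewrite char_sum_subgroup.
rewrite -big_mkcond /= sumr_const mulr_natr cardsE => ->.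
rewrite (bigD1 0) //= [X in _ + X]big1 ?addr0 => [|c /andP[_ c0]]; last first.
  rewrite char_sum_additive //; case: ifP => // /forallP cW.
  by rewrite (b_ndl (fun w => eqP (cW w))) eqxx in c0.
by rewrite (eq_bigr (fun=> 1)) ?sumr_const // => w _; rewrite b0l char0.
Qed.

(** Fourier inversion on W: the c in T give the main term exactly, and each of the others, at most
    |W| in number, contributes at most M. *)
Lemma char_count (V : finType) (f : V -> W) (a : W) (T : {set W}) (M : algC) :
  0 <= M ->
  {in T, forall c v, b c (f v) = b c a} ->
  (forall c, c \notin T -> `|\sum_v chi (b c (f v))| <= M) ->
  `|#|[set v | f v == a]|%:R * #|W|%:R - #|T|%:R * #|V|%:R| <= #|W|%:R * M.
Proof.
move=> M0 fT fNT.
have bB c x y : b c (x - y) = b c x - b c y.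
  by apply: (addIr (b c y)); rewrite -bDr !subrK.
(* By nondegeneracy, the sum over c of chi (b c (f v - a)) is |W| if f v = a and 0 otherwise. *)
have -> : #|[set v | f v == a]|%:R * #|W|%:R
    = \sum_c \sum_v chi (b c (f v) - b c a).
  rewrite mulrC mulr_natr -sumr_const big_mkcond exchange_big /=.
  apply: eq_bigr => v _; rewrite inE.
  rewrite (eq_bigr (fun c => chi (b c (f v - a)))) => [|c _]; last by rewrite bB.
  rewrite (char_sum_additive (g := b^~ (f v - a))) //; case: eqP => [->|fva].
    by rewrite subrr; case: forallP => // -[] c; rewrite b0r.
  case: forallP => // bva; case: fva; apply/eqP; rewrite -subr_eq0; apply/eqP.
  by apply: b_ndr => c; apply/eqP/bva.
rewrite (bigID (mem T)) /= (eq_bigr (fun=> #|V|%:R)) => [|c cT]; last first.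
  rewrite (eq_bigr (fun=> 1)) ?sumr_const // => v _.
  by rewrite fT // subrr char0.
rewrite sumr_const [#|T|%:R * _]mulr_natl addrAC subrr add0r.
apply: le_trans (ler_norm_sum _ _ _) _.
rewrite mulr_natl -sumr_const big_mkcond ler_sum // => c _.
case: ifPn => // cT.
rewrite (eq_bigr (fun v => chi (b c (f v)) * (chi (b c a))^*)) => [|v _].
  by rewrite -mulr_suml normrM norm_conjC chi_norm mulr1 fNT.
by rewrite charB.
Qed.

End Pairing.
End CharacterSums.

(** * Counting *)

Section FiniteGroups.
Variables (U V : finZmodType) (g : U -> V).
Hypothesis gD : {morph g : x y / x + y >-> x + y}.

Lemma card_ker_image : (#|[set x | g x == 0%R]| * #|g @: setT| = #|U|)%N.
Proof.
have gN x y : g (x - y) = g x - g y.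
  by apply: (addIr (g y)); rewrite -gD !subrK.
rewrite mulnC -[RHS]cardsT -[RHS]sum1_card (partition_big_imset g) /=.
rewrite -sum_nat_const; apply: eq_bigr => _ /imsetP[u _ ->].
rewrite sum1dep_card -[LHS](card_imset _ (addrI u)); apply: eq_card => x.
rewrite !inE /=; apply/imsetP/eqP => [[y]|gx].
  by rewrite inE => /eqP y0 ->; rewrite gD y0 addr0.
by exists (x - u); rewrite ?inE ?gN ?gx ?subrr // addrC subrK.
Qed.

End FiniteGroups.

Lemma card_ord_lt (m j : nat) :
  (j <= m)%N -> #|[pred i : 'I_m | (i < j)%N]| = j.
Proof.
move=> jm; rewrite -sum1_card -(big_ord_widen m (fun=> 1%N) jm).
by rewrite sum_nat_const card_ord muln1.
Qed.

Lemma card_ord_pairs_lt (m : nat) :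
  #|[pred x : 'I_m * 'I_m | (x.1 < x.2)%N]| = 'C(m, 2).
Proof.
rewrite -sum1_card -bin2_sum big_mkord.
rewrite -(pair_big_dep xpredT (fun i j : 'I_m => (i < j)%N) (fun _ _ => 1%N)) /=.
rewrite (exchange_big_dep xpredT) //=; apply: eq_bigr => j _.
by rewrite sum1_card card_ord_lt // ltnW.
Qed.

Lemma card_ord_pairs_le (m : nat) :
  #|[pred x : 'I_m * 'I_m | (x.1 <= x.2)%N]| = 'C(m.+1, 2).
Proof.
rewrite -sum1_card -bin2_sum big_nat_recl // add0n big_mkord.
rewrite -(pair_big_dep xpredT (fun i j : 'I_m => (i <= j)%N) (fun _ _ => 1%N)) /=.
rewrite (exchange_big_dep xpredT) //=; apply: eq_bigr => j _.
by rewrite sum1_card (@card_ord_lt m j.+1).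
Qed.

Section SymmetricMatrices.
Variables (F : finFieldType) (m : nat).

Lemma leq_card_entries (S : {set 'M[F]_m}) (P : pred ('I_m * 'I_m)) :
  {in S &, forall A B : 'M[F]_m, (forall x, P x -> A x.1 x.2 = B x.1 x.2) -> A = B} ->
  (#|S| <= #|F| ^ #|P|)%N.
Proof.
move=> SP; pose e (A : 'M[F]_m) := [ffun x : {x | P x} => A (val x).1 (val x).2].
rewrite -(@card_in_imset _ _ e) => [|A B AS BS /ffunP eAB].
  by rewrite -[#|P|]card_sig -card_ffun max_card.
apply: SP => // x Px; have := eAB (exist _ x Px); by rewrite !ffunE.
Qed.

Lemma leq_card_sym :
  (#|[set A : 'M[F]_m | A^T == A]| <= #|F| ^ 'C(m.+1, 2))%N.
Proof.
rewrite -card_ord_pairs_le; apply: leq_card_entries => A B.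
rewrite !inE => /eqP AE /eqP BE AB; apply/matrixP => i j.
case: (leqP i j) => [ij|/ltnW ji]; first exact: (AB (i, j)).
by rewrite -AE -BE !mxE; apply: (AB (j, i)).
Qed.

Lemma leq_card_skew : (2%:R : F) != 0 ->
  (#|[set A : 'M[F]_m | A^T == - A]| <= #|F| ^ 'C(m, 2))%N.
Proof.
move=> F2; rewrite -card_ord_pairs_lt; apply: leq_card_entries => A B.
rewrite !inE => /eqP AE /eqP BE AB.
(* Since 2 is invertible, the diagonal vanishes and the entries strictly above it determine the
   matrix. *)
have diag (C : 'M[F]_m) i : C^T = - C -> C i i = 0.
  move=> /matrixP/(_ i i); rewrite !mxE => /eqP; rewrite -addr_eq0 -mulr2n.
  by rewrite -mulr_natl mulf_eq0 (negPf F2) => /eqP.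
apply/matrixP => i j; case: (ltngtP i j) => [ij|ji|/val_inj->].
- exact: (AB (i, j)).
- have /matrixP/(_ j i) := AE; have /matrixP/(_ j i) := BE; rewrite !mxE => -> ->.
  by congr (- _); apply: (AB (j, i)).
- by rewrite !diag.
Qed.

End SymmetricMatrices.

(** * The relations of the pattern *)

Section Sylvester.
Variable F : finFieldType.

Lemma horner_mx_sylvester (k : nat) (A B Y : 'M[F]_k.+1) (q : {poly F}) :
  A *m Y = Y *m B -> horner_mx A q *m Y = Y *m horner_mx B q.
Proof.
move=> AYB; elim/poly_ind: q => [|q c IHq]; first by rewrite !rmorph0 mul0mx mulmx0.
rewrite !rmorphD !rmorphM /= !horner_mx_X !horner_mx_C mulmxDl mulmxDr.
rewrite -!mulmxE -mulmxA AYB mulmxA IHq -mulmxA; congr (_ + _).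
by rewrite scalar_mxC.
Qed.

(* With chi the characteristic polynomial of J, the equation gives
   0 = chi(J)^T Y = Y chi(-J), and chi(-J) is invertible because no -l with l
   an eigenvalue of J is an eigenvalue. *)
Lemma sylvester_eq0 (k : nat) (J Y : 'M[F]_k) :
  no_opposite_eigenvalues J -> J^T *m Y + Y *m J = 0 -> Y = 0.
Proof.
(* Evaluating polynomials at a matrix needs a ring of matrices, hence a positive size. *)
case: k J Y => [|k] J Y Jopp; first by rewrite [Y]flatmx0.
move/eqP; rewrite addr_eq0 -mulmxN => /eqP JY.
have /eqP := horner_mx_sylvester (char_poly J) JY.
have trJ : char_poly J = char_poly J^T.
  by rewrite /char_poly -det_tr /char_poly_mx linearB /= tr_scalar_mx map_trmx.
rewrite {1}trJ Cayley_Hamilton mul0mx eq_sym => /eqP Y0.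
suff chiU : horner_mx (- J) (char_poly J) \in unitmx.
  by rewrite -[Y]mulmx1 -(mulmxV chiU) mulmxA Y0 mul0mx.
pose f := toFbar F; rewrite -(map_unitmx f) map_horner_mx map_char_poly.
set Jf := map_mx f J; rewrite raddfN /= -/Jf.
have [rs chiE] := closed_field_poly_normal (char_poly Jf).
have /eqP lead1 : lead_coef (char_poly Jf) == 1 by apply: char_poly_monic.
rewrite lead1 scale1r in chiE; rewrite chiE rmorph_prod.
have rsP z : z \in rs -> root (char_poly Jf) z.
  by move=> zrs; rewrite chiE root_prod_XsubC.
elim: rs {chiE} rsP => [|z rs IHrs] rsP.
  by rewrite big_nil unitmx1.
rewrite big_cons -mulmxE unitmx_mul IHrs => [|y yrs]; last first.
  by apply: rsP; rewrite inE yrs orbT.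
rewrite andbT rmorphB /= horner_mx_X horner_mx_C.
have zroot : eigenvalue Jf z by rewrite eigenvalue_root_char rsP ?mem_head.
rewrite -row_free_unit -kermx_eq0.
apply/negPn/negP => /rowV0Pn[v /sub_kermxP vJ v0].
have nzroot : eigenvalue Jf (- z).
  apply/eigenvalueP; exists v => //; apply/eqP.
  move: vJ; rewrite mulmxBr mulmxN mul_mx_scalar => /eqP.
  by rewrite subr_eq0 scaleNr eqr_oppLR.
by have /eqP := Jopp _ _ zroot nzroot; rewrite opprK.
Qed.

End Sylvester.

(** * The trace form on quadruples of matrices *)

Section QuadProduct.
Variable F : finFieldType.

Lemma mxtrace_trmulE (m n : nat) (A B : 'M[F]_(m, n)) :
  \tr (A^T *m B) = \sum_i \sum_j A i j * B i j.
Proof.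
rewrite /mxtrace exchange_big; apply: eq_bigr => j _.
by rewrite mxE; apply: eq_bigr => i _; rewrite mxE.
Qed.

Lemma mxtrace_trmulC (m n : nat) (A B : 'M[F]_(m, n)) :
  \tr (A^T *m B) = \tr (B^T *m A).
Proof. by rewrite -mxtrace_tr trmx_mul trmxK. Qed.

Lemma mxtrace_trmul_eq0 (m n : nat) (A : 'M[F]_(m, n)) :
  (forall B, \tr (A^T *m B) = 0) -> A = 0.
Proof.
move=> A0; apply/matrixP => i j; rewrite mxE -[RHS](A0 (delta_mx i j)).
rewrite mxtrace_trmulE (bigD1 i) //= (bigD1 j) //= !mxE !eqxx mulr1.
rewrite !big1 ?addr0 // => [i' /negPf ii|j' /negPf jj].
  by apply: big1 => j' _; rewrite mxE ii mulr0.
by rewrite mxE jj andbF mulr0.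
Qed.

Variables m n : nat.
Implicit Types v w : quad 'M[F]_(m, n).

(** Extends [pairing] to rectangular matrices, so that it also serves quadruples of columns. *)
Definition quad_dot v w : F :=
  let: (x1, x2, x3, x4) := v in let: (y1, y2, y3, y4) := w in
  \tr (x1^T *m y1) + \tr (x2^T *m y2) + \tr (x3^T *m y3) + \tr (x4^T *m y4).

Arguments quad_dot : simpl nomatch.

Lemma quad_dotC v w : quad_dot v w = quad_dot w v.
Proof.
case: v w => [[[v1 v2] v3] v4] [[[w1 w2] w3] w4] /=.
by rewrite mxtrace_trmulC [X in _ + X]mxtrace_trmulC
  [X in _ + X + _]mxtrace_trmulC [X in _ + X + _ + _]mxtrace_trmulC.
Qed.

Lemma quad_dotDr v : {morph quad_dot v : x y / x + y >-> x + y}.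
Proof.
case: v => [[[v1 v2] v3] v4] [[[x1 x2] x3] x4] [[[y1 y2] y3] y4] /=.
by rewrite !mulmxDr !mxtraceD; ring.
Qed.

Lemma quad_dotDl w : {morph quad_dot^~ w : x y / x + y >-> x + y}.
Proof. by move=> x y /=; rewrite (quad_dotC (x + y)) quad_dotDr !(quad_dotC w). Qed.

Lemma quad_dot_eq0 v : (forall w, quad_dot v w = 0) -> v = 0.
Proof.
case: v => [[[v1 v2] v3] v4] v0.
have [v10 v20 v30 v40] : [/\ v1 = 0, v2 = 0, v3 = 0 & v4 = 0].
  split; apply: mxtrace_trmul_eq0 => B.
  - by have := v0 (B, 0, 0, 0); rewrite /= !mulmx0 !mxtrace0 !addr0.
  - by have := v0 (0, B, 0, 0); rewrite /= !mulmx0 !mxtrace0 !addr0 add0r.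
  - by have := v0 (0, 0, B, 0); rewrite /= !mulmx0 !mxtrace0 !addr0 !add0r.
  - by have := v0 (0, 0, 0, B); rewrite /= !mulmx0 !mxtrace0 !add0r.
by rewrite v10 v20 v30 v40.
Qed.

End QuadProduct.

Section Pattern.
Variables (F : finFieldType) (k : nat) (J : 'M[F]_k).
Implicit Types (c : quad 'M[F]_k) (s : F).

(* The four points of the pattern are [row_mx 1%:M B *m col_mx X D], with
   B = 0, 1, J, 1 + J. *)
Definition slot (B : 'M[F]_k) : 'M[F]_(k, k + k) := row_mx 1%:M B.

(** The adjoint of the quadratic pattern: it turns a coefficient quadruple into the matrix that is
    paired with Z M Z^T, where Z stacks X on D. *)
Definition pull c : 'M[F]_(k + k) :=
  let: (c1, c2, c3, c4) := c in
  let pb B x := (slot B)^T *m x *m slot B in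
  pb 0 c1 + pb 1%:M c2 + pb J c3 + pb (1%:M + J) c4.

Definition pull_lin (c : quad 'cV[F]_k) : 'cV[F]_(k + k) :=
  let: (c1, c2, c3, c4) := c in
  (slot 0)^T *m c1 + (slot 1%:M)^T *m c2 + (slot J)^T *m c3
    + (slot (1%:M + J))^T *m c4.

Lemma slotE (n : nat) (B : 'M[F]_k) (X D : 'M[F]_(k, n)) :
  slot B *m col_mx X D = X + B *m D.
Proof. by rewrite mul_row_col mul1mx. Qed.

Lemma quad_dot_quadratic (n : nat) c (M : 'M[F]_n) (X D : 'M[F]_(k, n)) :
  quad_dot c (on_pattern J (fun Y => Y *m M *m Y^T) X D)
    = \tr ((pull c)^T *m (col_mx X D *m M *m (col_mx X D)^T)).
Proof.
pose Q := col_mx X D *m M *m (col_mx X D)^T.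
have slot_tr B (x Y : 'M_k) : Y = slot B *m Q *m (slot B)^T ->
    \tr (x^T *m Y) = \tr (((slot B)^T *m x *m slot B)^T *m Q).
  by move=> ->; rewrite !trmx_mul trmxK !mulmxA mxtrace_mulC !mulmxA.
have val B (Y : 'M_(k, n)) : Y = slot B *m col_mx X D ->
    Y *m M *m Y^T = slot B *m Q *m (slot B)^T.
  by move=> ->; rewrite trmx_mul !mulmxA.
case: c => [[[c1 c2] c3] c4] /=.
rewrite ![in RHS]linearD /= ![in RHS]mulmxDl ![in RHS]mxtraceD.
by congr (_ + _ + _ + _); apply/slot_tr/val;
  rewrite slotE ?mul0mx ?addr0 ?mul1mx.
Qed.

Lemma quad_dot_linear (n : nat) (c : quad 'cV[F]_k) (r : 'cV[F]_n)
    (X D : 'M[F]_(k, n)) :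
  quad_dot c (on_pattern J (fun Y => Y *m r) X D)
    = \tr ((pull_lin c)^T *m (col_mx X D *m r)).
Proof.
case: c => [[[c1 c2] c3] c4] /=.
rewrite ![in RHS]linearD /= ![in RHS]mulmxDl ![in RHS]mxtraceD.
have val B (x : 'cV_k) (Y : 'M_(k, n)) : Y = slot B *m col_mx X D ->
    \tr (x^T *m (Y *m r)) = \tr (((slot B)^T *m x)^T *m (col_mx X D *m r)).
  by move=> ->; rewrite trmx_mul trmxK !mulmxA.
by congr (_ + _ + _ + _); apply: val; rewrite slotE ?mul0mx ?addr0 ?mul1mx.
Qed.

Definition quad_tr c : quad 'M[F]_k :=
  let: (c1, c2, c3, c4) := c in (c1^T, c2^T, c3^T, c4^T).

Lemma pull_tr c : (pull c)^T = pull (quad_tr c).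
Proof.
case: c => [[[c1 c2] c3] c4] /=.
by rewrite !linearD /= !trmx_mul !trmxK !mulmxA.
Qed.

Lemma pullD : {morph pull : c d / c + d >-> c + d}.
Proof.
move=> [[[c1 c2] c3] c4] [[[d1 d2] d3] d4] /=.
rewrite !mulmxDr !mulmxDl [RHS]addrACA; congr (_ + _).
by rewrite [RHS]addrACA; congr (_ + _); rewrite [RHS]addrACA.
Qed.

Lemma pullZ a c : pull (a *: c) = a *: pull c.
Proof.
case: c => [[[c1 c2] c3] c4] /=.
by rewrite -!scalemxAr -!scalemxAl !scalerDr.
Qed.

Lemma pullE c : let: (c1, c2, c3, c4) := c in
  pull c = block_mx (c1 + c2 + c3 + c4) (c2 + c3 *m J + c4 *m (1%:M + J))
    (c2 + J^T *m c3 + (1%:M + J)^T *m c4)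
    (c2 + J^T *m c3 *m J + (1%:M + J)^T *m c4 *m (1%:M + J)).
Proof.
have pb B (x : 'M[F]_k) : (slot B)^T *m x *m slot B
    = block_mx x (x *m B) (B^T *m x) (B^T *m x *m B).
  by rewrite /slot tr_row_mx mul_col_mx mul_col_row trmx1 !mul1mx !mulmx1.
case: c => [[[c1 c2] c3] c4]; rewrite /= !pb !add_block_mx.
by rewrite trmx0 trmx1 !mulmx0 !mul0mx !mulmx1 !mul1mx !add0r.
Qed.

(** Converse of [pull_relation], with A = c4. The off-diagonal blocks give J^T E = E J for E = c3 +
    c4; the Sylvester equation then yields c3 - c4 = E J, from which the other components follow. *)
Lemma pull_eq0 c : 1%:M - J \in unitmx -> no_opposite_eigenvalues J ->
  pull c = 0 -> exists2 A, A \in Xi J & c = relation_of J A.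
Proof.
move=> uJ Jopp; have := pullE c; case: c => [[[c1 c2] c3] c4] -> /eqP.
rewrite block_mx_eq0 => /and4P[/eqP e1 /eqP e2 /eqP e3 /eqP e4].
move: e2 e3 e4; rewrite mulmxDr mulmx1 linearD /= trmx1 !mulmxDl !mul1mx.
rewrite !mulmxDr !mulmx1 => e2 e3 e4.
have EJ : J^T *m (c3 + c4) = (c3 + c4) *m J.
  rewrite mulmxDr mulmxDl; apply/eqP; rewrite -subr_eq0; apply/eqP.
  rewrite -[RHS](subrr 0) -{1}e3 -e2; apply/matrixP => i j; rewrite !mxE; ring.
have e42 : J^T *m (c3 + c4) *m J - c3 *m J + J^T *m c4 = 0.
  rewrite -[RHS](subrr 0) -{1}e4 -e2 mulmxDr mulmxDl.
  by apply/matrixP => i j; rewrite !mxE; ring.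
have e43 : J^T *m (c3 + c4) *m J - J^T *m c3 + c4 *m J = 0.
  rewrite -[RHS](subrr 0) -{1}e4 -e3 mulmxDr mulmxDl.
  by apply/matrixP => i j; rewrite !mxE; ring.
(* Adding [e42] and [e43] and using [EJ] gives J^T Y + Y J = 0 for Y = (c3 + c4) J - (c3 - c4). *)
have c34 : c3 - c4 = (c3 + c4) *m J.
  apply/eqP; rewrite eq_sym -subr_eq0; apply/eqP/(sylvester_eq0 Jopp).
  rewrite -[RHS](addr0 0) -{1}e42 -e43 !(mulmxBr, mulmxBl) mulmxA EJ.
  by apply/matrixP => i j; rewrite !mxE; ring.
have c4J : J^T *m c4 = c4 *m J.
  apply/eqP; rewrite -subr_eq0; apply/eqP; rewrite -[RHS]oppr0 -e43 -mulmxA -c34.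
  rewrite mulmxBr; apply/matrixP => i j; rewrite !mxE; ring.
(* This is [c34] rearranged as c3 (1 - J) = c4 (1 + J). *)
have c3K : c3 = c4 *m ((1%:M + J) *m invmx (1%:M - J)).
  rewrite mulmxA; apply: (canRL (mulmxK uJ)); rewrite mulmxBr mulmxDr !mulmx1.
  apply/eqP; rewrite -subr_eq0; apply/eqP; rewrite -[RHS](subrr (c3 - c4)) {2}c34.
  by rewrite mulmxDl; apply/matrixP => i j; rewrite !mxE; ring.
exists c4; rewrite ?inE ?c4J // /relation_of -c3K.
have c23 : c2 = - c3.
  apply/eqP; rewrite -addr_eq0; apply/eqP; rewrite -[RHS](subrr (c3 - c4)) {2}c34.
  rewrite -[c3 - c4]addr0 -e2 mulmxDl.
  by apply/matrixP => i j; rewrite !mxE; ring.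
congr (_, _, _, _) => //; apply/eqP; rewrite -addr_eq0.
by rewrite -e1 c23 addrNK.
Qed.

End Pattern.

Section Annihilators.
Variables (F : finFieldType) (k : nat) (J : 'M[F]_k).
Implicit Types (c v w : quad 'M[F]_k) (s : F).

Lemma quad_dot_tr c v : quad_dot (quad_tr c) v = quad_dot c (quad_tr v).
Proof.
case: c v => [[[c1 c2] c3] c4] [[[v1 v2] v3] v4] /=.
have tr_tr (x y : 'M[F]_k) : \tr (x^T^T *m y) = \tr (x^T *m y^T).
  by rewrite -[LHS]mxtrace_tr trmx_mul trmxK mxtrace_mulC.
by rewrite !tr_tr.
Qed.

Lemma quad_dotZr a c v : quad_dot c (a *: v) = a * quad_dot c v.
Proof.
case: c v => [[[c1 c2] c3] c4] [[[v1 v2] v3] v4] /=.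
by rewrite -!scalemxAr !mxtraceZ !mulrDr.
Qed.

Lemma quad_dotZl a c v : quad_dot (a *: c) v = a * quad_dot c v.
Proof. by rewrite quad_dotC quad_dotZr quad_dotC. Qed.

Lemma quad_trD : {morph @quad_tr F k : c d / c + d >-> c + d}.
Proof.
by move=> [[[c1 c2] c3] c4] [[[d1 d2] d3] d4]; congr (_, _, _, _); rewrite linearD.
Qed.

Lemma quad_trZ a c : quad_tr (a *: c) = a *: quad_tr c.
Proof.
by case: c => [[[c1 c2] c3] c4]; congr (_, _, _, _); rewrite linearZ.
Qed.

Lemma quad_trK : involutive (@quad_tr F k).
Proof. by move=> [[[c1 c2] c3] c4]; congr (_, _, _, _); rewrite trmxK. Qed.

Lemma all4_trE s v : all4 (fun A => A^T == s *: A) v = (quad_tr v == s *: v).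
Proof.
by case: v => [[[v1 v2] v3] v4]; rewrite /= -!pair_eqE /= /pair_eq /= -!andbA.
Qed.

(** K is a rational function of J, so it commutes with J; since A intertwines J with J^T, it also
    intertwines K with K^T. *)
Lemma relation_mul_comm (A : 'M[F]_k) : 1%:M - J \in unitmx -> A \in Xi J ->
  let K := (1%:M + J) *m invmx (1%:M - J) in
  [/\ K *m (1%:M - J) = 1%:M + J, K *m J = J *m K & A *m K = K^T *m A].
Proof.
move=> uJ; rewrite inE => /eqP JA K.
have KJ1 : K *m (1%:M - J) = 1%:M + J by rewrite mulmxKV.
have commJ : (1%:M + J) *m (1%:M - J) = (1%:M - J) *m (1%:M + J).
  rewrite !(mulmxDr, mulmxDl, mulmxN, mulNmx, mulmx1, mul1mx).
  by apply/matrixP => i j; rewrite !mxE; ring.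
have K1J : (1%:M - J) *m K = 1%:M + J by rewrite mulmxA -commJ mulmxK.
have KJ : K *m J = J *m K.
  have : K *m (1%:M - J) = (1%:M - J) *m K by rewrite KJ1 K1J.
  by rewrite mulmxBr mulmxBl mulmx1 mul1mx => /addrI/oppr_inj.
split=> //; apply: (can_inj (mulmxK uJ)); rewrite -mulmxA KJ1.
rewrite -mulmxA [A *m (1%:M - J)]mulmxBr mulmx1 -JA.
have -> : A - J^T *m A = (1%:M - J)^T *m A.
  by rewrite [(1%:M - J)^T]linearB /= trmx1 mulmxBl mul1mx.
rewrite mulmxA -trmx_mul K1J [(1%:M + J)^T]linearD /= trmx1 mulmxDl mul1mx JA.
by rewrite mulmxDr mulmx1.
Qed.

Lemma pull_relation (A : 'M[F]_k) : 1%:M - J \in unitmx -> A \in Xi J ->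
  pull J (relation_of J A) = 0.
Proof.
move=> uJ AJ; have [KJ1 KJ AK] := relation_mul_comm uJ AJ.
have := pullE J (relation_of J A); rewrite /relation_of.
set K := _ *m invmx _ in KJ1 KJ AK * => ->.
clearbody K; move: AJ; rewrite inE => /eqP JA.
have e2 : - (A *m K) + A *m K *m J + A *m (1%:M + J) = 0.
  rewrite -KJ1 mulmxA mulmxBr mulmx1.
  by apply/matrixP => i j; rewrite !mxE; ring.
have JAK : J^T *m (A *m K) = A *m K *m J by rewrite mulmxA JA -!mulmxA KJ.
have J1A : (1%:M + J)^T *m A = A *m (1%:M + J).
  by rewrite [(1%:M + J)^T]linearD /= trmx1 mulmxDl mul1mx JA mulmxDr mulmx1.
apply/eqP; rewrite block_mx_eq0; apply/and4P; split; apply/eqP => //.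
- by apply/matrixP => i j; rewrite !mxE; ring.
- by rewrite JAK J1A.
(* The last block is [e2] times 1 + J on the right: the two terms A K J cancel. *)
rewrite JAK J1A -[RHS](mul0mx _ (1%:M + J)) -e2 !mulmxDl mulNmx.
rewrite [A *m K *m (1%:M + J)]mulmxDr [A *m K *m J *m (1%:M + J)]mulmxDr !mulmx1.
by apply/matrixP => i j; rewrite !mxE; ring.
Qed.

End Annihilators.

(** * Orthogonals of the relations and bounds on their size *)

Section Perps.
Variables (F : finFieldType) (chi : F -> algC).
Hypothesis chiP : faithful_char chi.
Hypothesis F2 : (2%:R : F) != 0.
Variables (k : nat) (J : 'M[F]_k).

(* With s = 1 (resp. -1): the coefficients whose pairing with the quadratic
   pattern of every symmetric (resp. skew-symmetric) matrix vanishes. *)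
Definition annihilator (s : F) : {set quad 'M[F]_k} :=
  [set c | pull J c + s *: (pull J c)^T == 0].

(** A common form of [LambdaPerp] and [LambdaPerp'], so that both signs share their proofs. *)
Definition signed_perp (s : F) : {set quad 'M[F]_k} :=
  [set v | all4 (fun A => A^T == s *: A) v
           && [forall w in [set relation_of J A | A in
                             [set A in Xi J | A^T == s *: A]], pairing v w == 0]].

Lemma LambdaPerp_signed : LambdaPerp J = signed_perp 1.
Proof.
apply/setP => -[[[v1 v2] v3] v4]; rewrite !inE /= !scale1r; congr (_ && _).
suff -> : Lambda J
  = [set relation_of J A | A in [set A in Xi J | A^T == 1 *: A]] by [].
apply: (congr1 (fun S : {set _} => [set relation_of J A | A in S])).
by apply/setP => A; rewrite !inE scale1r.
Qed.

Lemma LambdaPerp'_signed : LambdaPerp' J = signed_perp (- 1).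
Proof.
apply/setP => -[[[v1 v2] v3] v4]; rewrite !inE /= !scaleN1r; congr (_ && _).
suff -> : Lambda' J
  = [set relation_of J A | A in [set A in Xi J | A^T == -1 *: A]] by [].
apply: (congr1 (fun S : {set _} => [set relation_of J A | A in S])).
by apply/setP => A; rewrite !inE scaleN1r.
Qed.

Lemma pull_sign (s : F) c :
  pull J c + s *: (pull J c)^T = pull J (c + s *: quad_tr c).
Proof. by rewrite pull_tr -pullZ -pullD. Qed.

Section Sign.
Variable s : F.
Hypothesis s2 : s * s = 1.

Lemma annihilator0 : 0 \in annihilator s.
Proof. by rewrite inE -(scale0r 0) pullZ scale0r trmx0 scaler0 addr0. Qed.

Lemma annihilatorB : {in annihilator s &, forall c d, c - d \in annihilator s}.
Proof.
move=> c d; rewrite !inE -scaleN1r pullD pullZ => /eqP c0 /eqP d0.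
rewrite linearD linearZ /= scalerDr scalerA mulrC -scalerA addrACA.
by rewrite c0 -scalerDr d0 scaler0 addr0.
Qed.

(** The annihilator contains all s d - d^T, which force the symmetry type of v, and all relations.
    Conversely, for c in it, c + s c^T has zero pull-back, hence is a relation, and pairs with v to
    twice the value of c. *)
Lemma annihilator_orthogonal :
  1%:M - J \in unitmx -> no_opposite_eigenvalues J ->
  [set v | [forall c in annihilator s, quad_dot c v == 0]] = signed_perp s.
Proof.
move=> uJ Jopp; apply/setP => v; rewrite !inE all4_trE.
have pairingE w u : pairing w u = quad_dot w u :> F.
  by case: w u => [[[? ?] ?] ?] [[[? ?] ?] ?].
apply/forall_inP/andP => [v0|[/eqP vs /forall_inP vL] c].
  split.
    rewrite eq_sym -subr_eq0; apply/eqP/quad_dot_eq0 => d.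
    rewrite quad_dotC quad_dotDr -scaleN1r !quad_dotZr -quad_dot_tr.
    have := v0 (s *: d - quad_tr d); rewrite quad_dotDl quad_dotZl.
    rewrite -scaleN1r quad_dotZl => /(_ _)/eqP-> //.
    rewrite inE pull_sign quad_trD !quad_trZ quad_trK scalerDr !scalerA s2 mulrN1.
    rewrite scale1r scaleN1r scaleNr addrA subrK subrr.
    by rewrite -(scale0r 0) pullZ scale0r.
  apply/forall_inP => w /imsetP[A]; rewrite inE => /andP[AJ _] ->.
  rewrite pairingE quad_dotC; apply: v0.
  by rewrite inE pull_relation // trmx0 scaler0 addr0.
rewrite inE pull_sign => /eqP/(pull_eq0 uJ Jopp)[A AJ cA].
have /vL : relation_of J A \in
    [set relation_of J A | A in [set A in Xi J | A^T == s *: A]].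
  apply: imset_f; rewrite inE AJ /=.
  (* The quadruple c + s c^T has symmetry type s in every component; its last component is A. *)
  have : all4 (fun B => B^T == s *: B) (relation_of J A).
    rewrite all4_trE -cA quad_trD quad_trZ quad_trK scalerDr scalerA s2 scale1r.
    by rewrite addrC.
  by case/and4P.
rewrite pairingE -cA quad_dotDr quad_dotZr -quad_dot_tr vs quad_dotZl mulrA s2.
by rewrite mul1r -mulr2n -mulr_natl mulf_eq0 (negPf F2) quad_dotC.
Qed.

Lemma card_annihilator :
  1%:M - J \in unitmx -> no_opposite_eigenvalues J ->
  (#|annihilator s| * #|signed_perp s| = #|{: quad 'M[F]_k}|)%N.
Proof.
move=> uJ Jopp; rewrite -annihilator_orthogonal //.
apply: (card_orthogonal chiP) annihilator0 annihilatorB.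
- exact: quad_dotDl.
- exact: quad_dotDr.
- exact: quad_dot_eq0.
Qed.

(** The map c -> pull c + s (pull c)^T has kernel [annihilator s], so by [card_annihilator] its
    image has the size of [signed_perp s]; that image consists of 2k x 2k matrices of type s. *)
Lemma leq_card_signed_perp :
  1%:M - J \in unitmx -> no_opposite_eigenvalues J ->
  (#|signed_perp s| <= #|[set A : 'M[F]_(k + k) | A^T == s *: A]|)%N.
Proof.
move=> uJ Jopp; have cA := card_annihilator uJ Jopp.
pose g c := pull J c + s *: (pull J c)^T.
have gD : {morph g : c d / c + d >-> c + d}.
  by move=> c d; rewrite /g pullD linearD scalerDr addrACA.
have A_gt0 : (0 < #|annihilator s|)%N.
  by apply/card_gt0P; exists 0; apply: annihilator0.
rewrite -(leq_pmul2l A_gt0) cA -(card_ker_image gD) leq_mul2l.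
apply/orP; right; apply: subset_leq_card.
apply/subsetP => _ /imsetP[c _ ->]; rewrite inE /g linearD linearZ /= trmxK.
by rewrite scalerDr scalerA s2 scale1r addrC.
Qed.

End Sign.

Lemma Psi_pattern (z : 'cV[F]_k * 'cV[F]_k) :
  on_pattern J (fun Y => Y *m (1%:M : 'M_1)) z.1 z.2 \in Psi J.
Proof.
rewrite inE /on_pattern !mulmx1 mulmxDl mul1mx; apply/andP; split; apply/eqP.
  by apply/matrixP => i j; rewrite !mxE; ring.
rewrite [z.1 + z.2 - z.1]addrAC subrr add0r.
by apply/matrixP => i j; rewrite !mxE; ring.
Qed.

(** [Psi J] is exactly the set of values of the linear pattern with n = 1, whose adjoint is
    [pull_lin]. *)
Lemma Psi_orthogonal c :
  [forall x in Psi J, quad_dot c x == 0] = (pull_lin J c == 0).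
Proof.
apply/forall_inP/eqP => [c0|c0 [[[x1 x2] x3] x4]].
  apply: mxtrace_trmul_eq0 => B; rewrite -[B]vsubmxK -[col_mx _ _]mulmx1.
  rewrite -(quad_dot_linear J c 1%:M (usubmx B) (dsubmx B)); apply/eqP/c0.
  exact: (Psi_pattern (usubmx B, dsubmx B)).
rewrite inE => /andP[/eqP x0 /eqP xJ].
(* The point of [Psi J] is recovered from X = x1 and D = x2 - x1. *)
have -> : (x1, x2, x3, x4)
    = on_pattern J (fun Y => Y *m (1%:M : 'M_1)) x1 (x2 - x1).
  rewrite /on_pattern !mulmx1 mulmxDl mul1mx -xJ.
  congr (_, _, _, _); last 1 first.
  - by apply/matrixP => i j; rewrite !mxE; ring.
  - by rewrite addrC subrK.
  - by rewrite -[LHS]addr0 -x0; apply/matrixP => i j; rewrite !mxE; ring.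
by rewrite quad_dot_linear c0 trmx0 mul0mx mxtrace0.
Qed.

Lemma card_Psi_orthogonal :
  (#|Psi J| * #|[set c | pull_lin J c == 0%R]| = #|{: quad 'cV[F]_k}|)%N.
Proof.
rewrite -(@card_orthogonal F chi chiP _ (@quad_dot F k 1) (@quad_dotDl F k 1)
  (@quad_dotDr F k 1) (@quad_dot_eq0 F k 1) (Psi J)).
- congr (_ * _)%N; apply: eq_card => c; rewrite !inE -Psi_orthogonal.
  by apply: eq_forallb => x; rewrite quad_dotC.
- by rewrite -span_Psi mem0v.
- by move=> x y; rewrite -!span_Psi; apply: memvB.
Qed.

Lemma leq_card_Psi : (#|Psi J| <= #|F| ^ (2 * k))%N.
Proof.
rewrite -(@card_in_imset _ _ (fun x : quad 'cV[F]_k => (x.1.1.1, x.1.1.2))).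
  apply: leq_trans (max_card _) _.
  by rewrite card_prod !card_mx muln1 -expnD mul2n addnn.
move=> [[[x1 x2] x3] x4] [[[y1 y2] y3] y4]; rewrite !inE /=.
move=> /andP[/eqP x0 /eqP xJ] /andP[/eqP y0 /eqP yJ] [xy1 xy2].
rewrite -xy1 -xy2 in y0 yJ *; move: xJ; rewrite -yJ => /addIr xy4.
by rewrite xy4 in x0 *; move: x0; rewrite -y0 => /addIr/addrI/oppr_inj->.
Qed.

End Perps.

(** * Quadratic phases of high rank *)

Section QuadraticPhase.
Variables (F : finFieldType) (m n : nat).
Implicit Types (C : 'M[F]_m) (M : 'M[F]_n) (h w Z : 'M[F]_(m, n)).

(** Transposing inside the trace turns the value t into - s^2 t = - t. *)
Lemma quadratic_vanish (s : F) C M Z : (2%:R : F) != 0 -> s * s = 1 ->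
  M^T = s *: M -> C + s *: C^T = 0 -> \tr (C^T *m (Z *m M *m Z^T)) = 0.
Proof.
move=> F2 s2 MT C0; set t := \tr _.
have : t = - t.
  rewrite {1}/t -mxtrace_tr !trmx_mul !trmxK MT mxtrace_mulC.
  have -> : C = - s *: C^T by rewrite scaleNr; apply/eqP; rewrite -addr_eq0 C0.
  rewrite -!(scalemxAl, scalemxAr) !mxtraceZ mulrA mulNr s2 mulN1r.
  by rewrite /t !mulmxA.
by move/eqP; rewrite -addr_eq0 -mulr2n -mulr_natl mulf_eq0 (negPf F2) => /eqP.
Qed.

(** As M^T = s M, transposition merges the two cross terms into one polar form, linear in w. *)
Lemma quadratic_diff (s : F) C M h w : M^T = s *: M ->
  \tr (C^T *m ((w + h) *m M *m (w + h)^T)) - \tr (C^T *m (w *m M *m w^T))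
    = \tr ((C^T + s *: C) *m h *m M *m w^T) + \tr (C^T *m (h *m M *m h^T)).
Proof.
move=> MT.
have cross : \tr (C^T *m (w *m M *m h^T)) = \tr (s *: C *m h *m M *m w^T).
  rewrite -mxtrace_tr !trmx_mul !trmxK MT mxtrace_mulC.
  by rewrite -!(scalemxAl, scalemxAr) !mulmxA.
rewrite [(w + h)^T]linearD /= !(mulmxDl, mulmxDr) !mxtraceD -cross !mulmxA.
ring.
Qed.

Variables (d2 d3 r : nat).
Variables (M : 'I_d2 -> 'M[F]_n) (N : 'I_d3 -> 'M[F]_n).
Hypothesis MT : forall i, (M i)^T = M i.
Hypothesis NT : forall j, (N j)^T = - N j.
Hypothesis rankMN : forall (a : 'I_d2 -> F) (b : 'I_d3 -> F),
  (exists i, a i != 0) \/ (exists j, b j != 0) ->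
  (r <= \rank (\sum_i a i *: M i + \sum_j b j *: N j)%R)%N.

(** Some position (a, b) carries a nonzero coefficient. Row a of the image of this map contains the
    row space of the combination Q of the M_i and N_j with the (a, b) entries as coefficients, so
    the image has at least |F|^r elements. *)
Lemma card_ker_sum_mulmx (C : 'I_d2 -> 'M[F]_m) (C' : 'I_d3 -> 'M[F]_m) :
  (exists i, C i != 0) \/ (exists j, C' j != 0) ->
  (#|[set h | (\sum_i C i *m h *m M i + \sum_j C' j *m h *m N j == 0)%R]|
     * #|F| ^ r <= #|{: 'M[F]_(m, n)}|)%N.
Proof.
move=> CC'.
have [a [b ab]] : exists a b,
    (exists i, C i a b != 0) \/ (exists j, C' j a b != 0).
  have entry (A : 'M[F]_m) : A != 0 -> exists a b, A a b != 0.
    by move/matrix0Pn=> [a [b Aab]]; exists a, b.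
  by case: CC' => -[i /entry[a [b ab]]]; exists a, b; [left|right]; exists i.
pose G h := \sum_i C i *m h *m M i + \sum_j C' j *m h *m N j.
have GD : {morph G : x y / x + y >-> x + y}.
  move=> x y; rewrite /G addrACA -!big_split /=.
  by congr (_ + _); apply: eq_bigr => i _; rewrite mulmxDr mulmxDl.
rewrite -(card_ker_image GD) leq_mul2l; apply/orP; right.
set Q := \sum_i C i a b *: M i + \sum_j C' j a b *: N j.
apply: leq_trans (_ : #|rowg Q| <= _)%N.
  rewrite card_rowg leq_pexp2l ?rankMN //.
  by apply/card_gt0P; exists 0.
apply: leq_trans (leq_imset_card (row a) _).
apply: subset_leq_card; apply/subsetP => y; rewrite inE => /submxP[z ->].
(* The preimage is the matrix with row b equal to z and all other rows 0. *)
apply/imsetP; exists (G (delta_mx b 0 *m z)); first exact: imset_f.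
have rowC (A : 'M[F]_m) (P : 'M[F]_n) :
    row a (A *m (delta_mx b 0 *m z) *m P) = z *m (A a b *: P).
  rewrite !row_mul mulmxA -colE.
  have -> : col b (row a A) = (A a b)%:M.
    by apply/matrixP => i j; rewrite !mxE !ord1 eqxx.
  by rewrite mul_scalar_mx -scalemxAl scalemxAr.
rewrite /G /Q [in RHS]linearD /= ![in RHS]linear_sum mulmxDr !mulmx_sumr.
by congr (_ + _); apply: eq_bigr => i _; rewrite /= rowC.
Qed.

Variable chi : F -> algC.
Hypothesis chiP : faithful_char chi.

Lemma quadratic_char_sum (C : 'I_d2 -> 'M[F]_m) (C' : 'I_d3 -> 'M[F]_m)
    (l : 'M[F]_(m, n) -> F) :
  {morph l : x y / x + y >-> x + y} ->
  (exists i, C i + (C i)^T != 0) \/ (exists j, C' j - (C' j)^T != 0) ->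
  `|\sum_Z chi (l Z + \sum_i \tr ((C i)^T *m (Z *m M i *m Z^T))
                + \sum_j \tr ((C' j)^T *m (Z *m N j *m Z^T)))| ^+ 2
    * (#|F| ^ r)%:R <= (#|{: 'M[F]_(m, n)}| ^ 2)%:R.
Proof.
move=> lD nz.
pose G h := \sum_i ((C i)^T + 1 *: C i) *m h *m M i
  + \sum_j ((C' j)^T + (-1) *: C' j) *m h *m N j.
pose f Z := l Z + \sum_i \tr ((C i)^T *m (Z *m M i *m Z^T))
                + \sum_j \tr ((C' j)^T *m (Z *m N j *m Z^T)).
(* The part independent of w is [f h] itself, which absorbs the linear term l. *)
have fE h w : f (w + h) - f w = \tr (G h *m w^T) + f h.
  rewrite /f /G lD mulmxDl mxtraceD !mulmx_suml !raddf_sum /=.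
  have -> (a1 a2 b b' c c' : F) :
    a1 + a2 + b + c - (a1 + b' + c') = (b - b') + (c - c') + a2 by ring.
  rewrite -!sumrB.
  have dM i := quadratic_diff (C i) h w (etrans (MT i) (esym (scale1r (M i)))).
  have dN j := quadratic_diff (C' j) h w (etrans (NT j) (esym (scaleN1r (N j)))).
  rewrite (eq_bigr _ (fun i _ => dM i)) (eq_bigr _ (fun j _ => dN j)).
  rewrite !big_split /=; ring.
have GwD h : {morph (fun w => \tr (G h *m w^T)) : x y / x + y >-> x + y}.
  by move=> x y; rewrite linearD mulmxDr mxtraceD.
have := norm_sqr_char_sum chiP GwD fE.
set K := [set h | _] => bound.
have nz' : (exists i, (C i)^T + 1 *: C i != 0)
    \/ (exists j, (C' j)^T + (-1) *: C' j != 0).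
  case: nz => -[i Ci]; [left|right]; exists i.
    by rewrite scale1r addrC.
  by rewrite scaleN1r -opprB oppr_eq0.
have := card_ker_sum_mulmx nz'.
have -> : [set h | \sum_i ((C i)^T + 1 *: C i) *m h *m M i
    + \sum_j ((C' j)^T + -1 *: C' j) *m h *m N j == 0] = K.
  apply/setP => h; rewrite !inE; apply/eqP/forallP => [G0 w|G0].
    by rewrite /G G0 mul0mx mxtrace0.
  apply: mxtrace_trmul_eq0 => B; rewrite mxtrace_trmulC mxtrace_mulC.
  exact/eqP/G0.
rewrite -(ler_nat algC) natrM => cardK.
apply: le_trans (ler_wpM2r (ler0n _ _) bound) _.
by rewrite -mulrA -[X in _ <= X%:R]mulnn natrM ler_wpM2l ?ler0n.
Qed.

End QuadraticPhase.

(** * The count *)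

Section Count.
Variables (F : finFieldType) (chi : F -> algC).
Hypothesis chiP : faithful_char chi.
Hypothesis F2 : (2%:R : F) != 0.
Variables (k n d1 d2 d3 r : nat) (J : 'M[F]_k).
Variable B : sym_quad_factor F n d1 d2 d3.
Hypothesis uJ : 1%:M - J \in unitmx.
Hypothesis Jopp : no_opposite_eigenvalues J.
Hypothesis rankB : has_rank_ge B r.

(** Holds both the values of the pattern and the coefficients dual to them: the group W of
    [char_count]. *)
Definition atoms : finZmodType :=
  ({ffun 'I_d1 -> quad 'cV[F]_k} * {ffun 'I_d2 -> quad 'M[F]_k}
    * {ffun 'I_d3 -> quad 'M[F]_k})%type.

Implicit Types c w : atoms.

Definition atoms_dot c w : F :=
  \sum_i quad_dot (c.1.1 i) (w.1.1 i) + \sum_i quad_dot (c.1.2 i) (w.1.2 i)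
    + \sum_i quad_dot (c.2 i) (w.2 i).

Lemma atoms_dotC c w : atoms_dot c w = atoms_dot w c.
Proof.
by congr (_ + _ + _); apply: eq_bigr => i _; rewrite quad_dotC.
Qed.

Lemma atoms_dotDr c : {morph atoms_dot c : x y / x + y >-> x + y}.
Proof.
move=> x y; rewrite /atoms_dot [RHS]addrACA [X in _ = X + _]addrACA.
rewrite -!big_split /=.
by congr (_ + _ + _); apply: eq_bigr => i _; rewrite ffunE quad_dotDr.
Qed.

Lemma atoms_dotDl w : {morph atoms_dot^~ w : x y / x + y >-> x + y}.
Proof. by move=> x y; rewrite atoms_dotC atoms_dotDr !(atoms_dotC w). Qed.

Lemma atoms_dot_eq0 c : (forall w, atoms_dot c w = 0) -> c = 0.
Proof.
case: c => [[c1 c2] c3] c0.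
have dot0 m' n' (v : quad 'M[F]_(m', n')) : quad_dot v 0 = 0.
  by apply: (addrI (quad_dot v 0)); rewrite -quad_dotDr !addr0.
have pick d m' n' (v : {ffun 'I_d -> quad 'M[F]_(m', n')}) i u :
    \sum_j quad_dot (v j) ([ffun j' => if j' == i then u else 0] j)
      = quad_dot (v i) u.
  rewrite (bigD1 i) //= ffunE eqxx big1 ?addr0 // => j /negPf ji.
  by rewrite ffunE ji dot0.
have sum0 d m' n' (v : {ffun 'I_d -> quad 'M[F]_(m', n')}) :
    \sum_j quad_dot (v j) ((0 : {ffun 'I_d -> quad 'M[F]_(m', n')}) j) = 0.
  by apply: big1 => j _; rewrite ffunE dot0.
congr (_, _, _); apply/ffunP => i; rewrite ffunE; apply: quad_dot_eq0 => u.
- have := c0 ([ffun j => if j == i then u else 0], 0, 0).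
  by rewrite /atoms_dot /= pick !sum0 !addr0.
- have := c0 (0, [ffun j => if j == i then u else 0], 0).
  by rewrite /atoms_dot /= pick !sum0 addr0 add0r.
- have := c0 (0, 0, [ffun j => if j == i then u else 0]).
  by rewrite /atoms_dot /= pick !sum0 !add0r.
Qed.

Definition atom_values (Z : 'M[F]_(k + k, n)) : atoms :=
  ([ffun i => on_pattern J (B1 B i) (usubmx Z) (dsubmx Z)],
   [ffun i => on_pattern J (B2 B i) (usubmx Z) (dsubmx Z)],
   [ffun i => on_pattern J (B3 B i) (usubmx Z) (dsubmx Z)]).

Definition lin_phase c (Z : 'M[F]_(k + k, n)) : F :=
  \sum_i \tr ((pull_lin J (c.1.1 i))^T *m (Z *m lin_part B i)).

Lemma lin_phaseD c : {morph lin_phase c : x y / x + y >-> x + y}.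
Proof.
move=> x y; rewrite /lin_phase -big_split; apply: eq_bigr => i _.
by rewrite mulmxDl mulmxDr mxtraceD.
Qed.

Lemma atoms_dot_values c Z : atoms_dot c (atom_values Z) = lin_phase c Z
  + \sum_i \tr ((pull J (c.1.2 i))^T *m (Z *m sym_part B i *m Z^T))
  + \sum_j \tr ((pull J (c.2 j))^T *m (Z *m skew_part B j *m Z^T)).
Proof.
rewrite -[in RHS](vsubmxK Z).
congr (_ + _ + _); apply: eq_bigr => i _; rewrite ffunE.
- exact: quad_dot_linear.
- exact: quad_dot_quadratic.
- exact: quad_dot_quadratic.
Qed.

(** The set T of [char_count]: here the phase vanishes for every Z. Only the part of a pull-back
    with the symmetry type of the M_i or N_j matters. *)
Definition trivial_coeffs : {set atoms} :=
  setX (setX [set c : {ffun _} in ffun_on [set c | pull_lin J c == 0]]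
             [set c : {ffun _} in ffun_on (annihilator J 1)])
       [set c : {ffun _} in ffun_on (annihilator J (-1))].

Lemma trivial_coeffsP c :
  reflect [/\ forall i, pull_lin J (c.1.1 i) = 0,
              forall i, c.1.2 i \in annihilator J 1
            & forall i, c.2 i \in annihilator J (-1)] (c \in trivial_coeffs).
Proof.
case: c => [[c1 c2] c3]; rewrite !inE /=.
apply: (iffP andP) => [[/andP[h1 h2] /ffun_onP h3]|[h1 h2 h3]].
  move/ffun_onP: h1 => h1; move/ffun_onP: h2 => h2.
  by split=> // i; have := h1 i; rewrite inE => /eqP.
split; last exact/ffun_onP.
by apply/andP; split; apply/ffun_onP => // i; rewrite inE h1.
Qed.

Lemma card_trivial_coeffs :
  (#|trivial_coeffs|
     * (#|Psi J| ^ d1 * #|LambdaPerp J| ^ d2 * #|LambdaPerp' J| ^ d3)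
    = #|atoms|)%N.
Proof.
have -> : #|trivial_coeffs| = (#|[set c | pull_lin J c == 0%R]| ^ d1
    * #|annihilator J 1%R| ^ d2 * #|annihilator J (-1)%R| ^ d3)%N.
  by rewrite 2!cardsX; congr (_ * _ * _)%N; rewrite cardsE card_ffun_on card_ord.
have -> : #|atoms| = (#|{: quad 'cV[F]_k}| ^ d1 * #|{: quad 'M[F]_k}| ^ d2
    * #|{: quad 'M[F]_k}| ^ d3)%N.
  by rewrite !card_prod !card_ffun !card_ord !card_prod.
rewrite -(card_Psi_orthogonal chiP J) LambdaPerp_signed LambdaPerp'_signed.
have s1 : 1 * 1 = 1 :> F by rewrite mulr1.
have sN1 : -1 * -1 = 1 :> F by rewrite mulrNN mulr1.
rewrite -{1}(card_annihilator chiP F2 s1 uJ Jopp).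
rewrite -(card_annihilator chiP F2 sN1 uJ Jopp) !expnMn.
rewrite mulnACA; congr (_ * _)%N; rewrite mulnACA; congr (_ * _)%N.
exact: mulnC.
Qed.

Lemma atoms_dot_values_trivial c Z : c \in trivial_coeffs ->
  atoms_dot c (atom_values Z) = 0.
Proof.
move=> /trivial_coeffsP[c1 c2 c3]; rewrite atoms_dot_values.
rewrite /lin_phase !big1 ?addr0 // => i _.
- have := c3 i; rewrite inE => /eqP; apply: quadratic_vanish => //.
    by rewrite mulrNN mulr1.
  by rewrite skew_partP scaleN1r.
- have := c2 i; rewrite inE => /eqP; apply: quadratic_vanish => //.
    by rewrite mulr1.
  by rewrite sym_partP scale1r.
- by rewrite c1 trmx0 mul0mx mxtrace0.
Qed.

Lemma lin_phase_eq0 c :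
  (forall Z, lin_phase c Z = 0) -> forall i, pull_lin J (c.1.1 i) = 0.
Proof.
move=> l0 i; apply/matrixP => a b; rewrite ord1 mxE {b}.
have [freeB _] := rankB.
pose X := mktuple (lin_part B).
have /freeP freeX : free X by [].
apply: (freeX (fun i => pull_lin J (c.1.1 i) a 0)).
apply: mxtrace_trmul_eq0 => y; rewrite mxtrace_trmulC.
(* Testing on the matrix with row a equal to y^T extracts the pairing of y with a combination of the
   r_j. *)
rewrite -[RHS](l0 (delta_mx a 0 *m y^T)) mulmx_sumr raddf_sum.
apply: eq_bigr => j _; rewrite -tnth_nth tnth_mktuple /= -scalemxAr mxtraceZ.
rewrite !mulmxA -[(pull_lin J _)^T *m _]colE.
have -> : col a (pull_lin J (c.1.1 j))^T = (pull_lin J (c.1.1 j) a 0)%:M.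
  by apply/matrixP => x z; rewrite !mxE !ord1 eqxx.
by rewrite mul_scalar_mx -scalemxAl mxtraceZ.
Qed.

Lemma char_sum_nontrivial c : c \notin trivial_coeffs ->
  `|\sum_Z chi (atoms_dot c (atom_values Z))| ^+ 2 * (#|F| ^ r)%:R
    <= (#|{: 'M[F]_(k + k, n)}| ^ 2)%:R.
Proof.
move=> cT; under eq_bigr do rewrite atoms_dot_values.
have [_ rk] := rankB.
have MT i : (sym_part B i)^T = sym_part B i by apply: sym_partP.
have NT j : (skew_part B j)^T = - skew_part B j by apply: skew_partP.
case: (pickP (fun i => c.1.2 i \notin annihilator J 1)) => [i ci|c2].
  apply: (quadratic_char_sum MT NT rk chiP (lin_phaseD c)); left; exists i.
  by move: ci; rewrite inE scale1r.
case: (pickP (fun i => c.2 i \notin annihilator J (-1))) => [i ci|c3].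
  apply: (quadratic_char_sum MT NT rk chiP (lin_phaseD c)); right; exists i.
  by move: ci; rewrite inE scaleN1r.
under eq_bigr do rewrite -atoms_dot_values.
rewrite (eq_bigr (fun Z => chi (lin_phase c Z))) => [|Z _]; last first.
  rewrite atoms_dot_values; congr chi.
  rewrite [X in _ + X]big1 ?addr0 => [|i _].
    rewrite big1 ?addr0 // => i _.
    have /negPn := negbT (c2 i); rewrite inE => /eqP; apply: quadratic_vanish => //.
      by rewrite mulr1.
    by rewrite MT scale1r.
  have /negPn := negbT (c3 i); rewrite inE => /eqP; apply: quadratic_vanish => //.
    by rewrite mulrNN mulr1.
  by rewrite NT scaleN1r.
(* Only the linear phase is left: if it vanished identically, c would be trivial; otherwise the sum
   is 0. *)
rewrite (char_sum_additive chiP (lin_phaseD c)); case: ifP => [/forallP l0|_].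
  case/trivial_coeffsP: cT; split=> i.
  - by apply: lin_phase_eq0 => Z; apply/eqP.
  - exact/negPn/negbT/c2.
  - exact/negPn/negbT/c3.
by rewrite normr0 expr0n mul0r ler0n.
Qed.

(** The estimate is squared and stated over the integers so that it passes from [algC], where the
    characters live, to the reals. *)
Lemma atom_values_count (a1 : 'I_d1 -> quad 'cV[F]_k)
    (a2 : 'I_d2 -> quad 'M[F]_k) (a3 : 'I_d3 -> quad 'M[F]_k) :
  (forall i, a1 i \in Psi J) -> (forall i, a2 i \in LambdaPerp J) ->
  (forall i, a3 i \in LambdaPerp' J) ->
  let a : atoms := ([ffun i => a1 i], [ffun i => a2 i], [ffun i => a3 i]) in
  let N := #|[set Z | atom_values Z == a]| in
  let m := (#|Psi J| ^ d1 * #|LambdaPerp J| ^ d2 * #|LambdaPerp' J| ^ d3)%N in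
  let v := #|{: 'M[F]_(k + k, n)}| in
  ((N * m)%:Z - v%:Z) ^+ 2 * (#|F| ^ r)%:Z <= ((m * v) ^ 2)%:Z.
Proof.
move=> a1P a2P a3P; cbv zeta; set a := (_, _, _); set N := #|[set _ | _]|.
set m := (_ ^ d1 * _ * _)%N; set v := #|{: 'M[F]_(k + k, n)}|.
have q_gt0 : 0 < (#|F| ^ r)%:R :> algC.
  by rewrite ltr0n expn_gt0; apply/orP; left; apply/card_gt0P; exists 0.
pose M : algC := sqrtC ((v ^ 2)%:R / (#|F| ^ r)%:R).
have M0 : 0 <= M by rewrite sqrtC_ge0 divr_ge0 // ?ler0n // ltW.
have triv : {in trivial_coeffs, forall c Z,
    atoms_dot c (atom_values Z) = atoms_dot c a}.
  move=> c cT Z; rewrite atoms_dot_values_trivial //.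
  case/trivial_coeffsP: cT => c1 c2 c3.
  rewrite /atoms_dot !big1 ?addr0 // => i _.
  - have s2 : -1 * -1 = 1 :> F by rewrite mulrNN mulr1.
    rewrite ffunE; have := a3P i; rewrite LambdaPerp'_signed.
    rewrite -(annihilator_orthogonal F2 s2) // inE.
    by move=> /forall_inP/(_ _ (c3 i))/eqP.
  - have s2 : 1 * 1 = 1 :> F by rewrite mulr1.
    rewrite ffunE; have := a2P i; rewrite LambdaPerp_signed.
    rewrite -(annihilator_orthogonal F2 s2) // inE.
    by move=> /forall_inP/(_ _ (c2 i))/eqP.
  - rewrite ffunE; have /eqP := c1 i; rewrite -Psi_orthogonal.
    by move=> /forall_inP/(_ _ (a1P i))/eqP.
have nontriv c : c \notin trivial_coeffs ->
    `|\sum_Z chi (atoms_dot c (atom_values Z))| <= M.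
  move=> /char_sum_nontrivial; rewrite -ler_pdivlMr // => S2.
  by rewrite -(ger0_norm M0) -ler_sqr ?nnegrE // ger0_norm // sqrtCK.
have ndr w : (forall c, atoms_dot c w = 0) -> w = 0.
  by move=> w0; apply: atoms_dot_eq0 => c; rewrite atoms_dotC.
have := char_count chiP atoms_dotDl atoms_dotDr ndr M0 triv nontriv.
rewrite -/N -/v -card_trivial_coeffs -/m natrM.
have T_gt0 : 0 < #|trivial_coeffs|%:R :> algC.
  rewrite ltr0n; apply/card_gt0P; exists 0; apply/trivial_coeffsP.
  split=> i; rewrite ffunE ?annihilator0 //.
  by rewrite /pull_lin /= !mulmx0 !addr0.
(* With |W| = |T| m, a factor |T| cancels from both sides. *)
rewrite mulrCA -mulrBr normrM ger0_norm ?ler0n // -mulrA ler_pM2l // => bound.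
rewrite -(ler_int algC) rmorphM rmorphXn rmorphB /= -!pmulrn.
rewrite -ler_pdivlMr // -real_normK ?rpredB ?realn //.
have -> : ((m * v) ^ 2)%:R / (#|F| ^ r)%:R = (m%:R * M) ^+ 2 :> algC.
  by rewrite expnMn natrM -mulrA exprMn sqrtCK -natrX.
by rewrite ler_sqr ?nnegrE ?normr_ge0 ?mulr_ge0 ?ler0n // natrM.
Qed.

End Count.

(** * Specialization to prime fields and real exponents *)

Lemma Fp_faithful_char (p : nat) : exists chi : 'F_p -> algC, faithful_char chi.
Proof.
(* The order of z is the bound of the ordinal type underlying ['F_p], so z ^+ x has trivial
   kernel. *)
have [//|z zP] := @C_prim_root_exists (Zp_trunc (pdiv p)).+2.
exists (fun x => z ^+ x); split=> [x y|x /eqP|x].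
- by rewrite -exprD -[RHS](prim_expr_mod zP).
- rewrite -(prim_order_dvd zP) => /eqP x0; apply: val_inj.
  exact: etrans (esym (modn_small (ltn_ord x))) x0.
- rewrite normrX; suff -> : `|z| = 1 by rewrite expr1n.
  apply/eqP; rewrite -(@pexpr_eq1 _ _ (Zp_trunc (pdiv p)).+2) // -normrX.
  by rewrite (prim_expr_order zP) normr1.
Qed.

Lemma bin2D (m n : nat) : 'C(m + n, 2) = ('C(m, 2) + 'C(n, 2) + m * n)%N.
Proof.
elim: m => [|m IHm]; first by rewrite add0n mul0n addn0.
by rewrite addSn !binS !bin1 IHm; ring.
Qed.

Lemma card_subspace (F : finFieldType) (m n : nat) (S : {set quad 'M[F]_(m, n)}) :
  <<enum S>>%VS =i S -> #|S| = (#|F| ^ fdim S)%N.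
Proof. by move=> /eq_card <-; rewrite card_vspace. Qed.

Section Dimensions.
Variables (p k : nat) (J : 'M['F_p]_k).
Hypothesis p_prime : prime p.
Hypothesis p_odd : odd p.
Hypothesis uJ : 1%:M - J \in unitmx.
Hypothesis Jopp : no_opposite_eigenvalues J.

Lemma Fp_two_neq0 : (2%:R : 'F_p) != 0.
Proof.
rewrite -(dvdn_pcharf (pchar_Fp p_prime)); apply/negP => /(@dvdn_leq p 2 isT) p2.
by have := prime_gt1 p_prime; move: p_odd p2; case: (p) => [|[|[|]]].
Qed.

Lemma card_Fp_subspace (m n : nat) (S : {set quad 'M['F_p]_(m, n)}) :
  <<enum S>>%VS =i S -> #|S| = (p ^ fdim S)%N.
Proof. by move=> /card_subspace ->; rewrite card_Fp. Qed.

Lemma leq_dim_Psi : (fdim (Psi J) <= 2 * k)%N.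
Proof.
rewrite -(leq_exp2l _ _ (prime_gt1 p_prime)) -(card_Fp_subspace (span_Psi J)).
by have := leq_card_Psi J; rewrite card_Fp.
Qed.

Lemma leq_dim_LambdaPerp : (fdim (LambdaPerp J) <= 2 * 'C(k.+1, 2) + k ^ 2)%N.
Proof.
have [chi chiP] := Fp_faithful_char p.
rewrite -(leq_exp2l _ _ (prime_gt1 p_prime)) -(card_Fp_subspace (span_LambdaPerp J)).
rewrite LambdaPerp_signed.
apply: leq_trans (leq_card_signed_perp chiP Fp_two_neq0 _ uJ Jopp) _.
  by rewrite mulr1.
have -> : [set A : 'M['F_p]_(k + k) | A^T == 1 *: A] = [set A | A^T == A].
  by apply/setP => A; rewrite !inE scale1r.
apply: leq_trans (leq_card_sym _ _) _; rewrite card_Fp // leq_exp2l ?prime_gt1 //.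
(* Used to split 2k + 1 as (k + 1) + k in C(2k + 1, 2). *)
have binSk : 'C(k.+1, 2) = ('C(k, 2) + k)%N by rewrite binS bin1.
by rewrite eq_leq // -addSn bin2D binSk; ring.
Qed.

Lemma leq_dim_LambdaPerp' : (fdim (LambdaPerp' J) <= 2 * 'C(k, 2) + k ^ 2)%N.
Proof.
have [chi chiP] := Fp_faithful_char p.
rewrite -(leq_exp2l _ _ (prime_gt1 p_prime)) -(card_Fp_subspace (span_LambdaPerp' J)).
rewrite LambdaPerp'_signed.
apply: leq_trans (leq_card_signed_perp chiP Fp_two_neq0 _ uJ Jopp) _.
  by rewrite mulrNN mulr1.
have -> : [set A : 'M['F_p]_(k + k) | A^T == -1 *: A] = [set A | A^T == - A].
  by apply/setP => A; rewrite !inE scaleN1r.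
apply: leq_trans (leq_card_skew _ Fp_two_neq0) _; rewrite card_Fp //.
by rewrite leq_exp2l ?prime_gt1 // eq_leq // bin2D; ring.
Qed.

End Dimensions.

(** The square root is taken here, which brings in the exponent - r / 2; monotonicity then replaces
    d by e. *)
Lemma ler_powR_half (R : realType) (p d e r : nat) (x : R) : (0 < p)%N ->
  (d <= e)%N -> x ^+ 2 * (p ^ r)%:R <= ((p ^ d) ^ 2)%:R ->
  `|x| <= (p%:R : R) `^ (- (r%:R / 2) + e%:R).
Proof.
move=> p_gt0 de xr; have p1 : 1 <= (p%:R : R) by rewrite ler1n.
have p0 : (p%:R : R) != 0 by rewrite pnatr_eq0 -lt0n.
apply: le_trans (_ : (p%:R : R) `^ (- (r%:R / 2) + d%:R) <= _); last first.
  by rewrite ler_powR // lerD2l ler_nat.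
rewrite -ler_sqr ?nnegrE ?powR_ge0 // real_normK ?num_real //.
rewrite -[leRHS]powR_mulrn ?powR_ge0 // -powRrM mulrDl mulNr divfK ?pnatr_eq0 //.
rewrite powRD ?p0 ?implybT // powRN powR_mulrn ?ler0n // -natrM powR_mulrn ?ler0n //.
by rewrite mulrC ler_pdivlMr -?natrX ?ltr0n ?expn_gt0 ?p_gt0 // expnM.
Qed.

Theorem theorem4p4 (R : realType) :
  exists C : R,
  forall (p k n d1 d2 d3 r : nat) (J : 'M['F_p]_k)
    (B : sym_quad_factor 'F_p n d1 d2 d3)
    (a1 : 'I_d1 -> quad 'cV['F_p]_k)
    (a2 : 'I_d2 -> quad 'M['F_p]_k)
    (a3 : 'I_d3 -> quad 'M['F_p]_k),
    prime p -> odd p -> (0 < k)%N -> (0 < n)%N ->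
    J \in unitmx -> 1%:M - J \in unitmx -> 1%:M + J \in unitmx ->
    no_opposite_eigenvalues J ->
    has_rank_ge B r ->
    (forall i, a1 i \in Psi J) ->
    (forall i, a2 i \in LambdaPerp J) ->
    (forall i, a3 i \in LambdaPerp' J) ->
    exists eps : R,
      `|eps| <= C * (p%:R : R) `^ (- (r%:R / 2)
          + (2 * k * d1 + (2 * 'C(k.+1, 2) + k ^ 2) * d2
             + (2 * 'C(k, 2) + k ^ 2) * d3)%N%:R)
      /\ unif_prob R (fun XD : 'M['F_p]_(k, n) * 'M['F_p]_(k, n) =>
            [&& [forall i, on_pattern J (B1 B i) XD.1 XD.2 == a1 i],
                [forall i, on_pattern J (B2 B i) XD.1 XD.2 == a2 i]
              & [forall i, on_pattern J (B3 B i) XD.1 XD.2 == a3 i]])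
         = (p%:R : R) ^- (d1 * fdim (Psi J) + d2 * fdim (LambdaPerp J)
                          + d3 * fdim (LambdaPerp' J))
           * (1 + eps).
Proof.
exists 1 => p k n d1 d2 d3 r J B a1 a2 a3 p_prime p_odd _ _ _ uJ _ Jopp rankB.
move=> a1P a2P a3P; rewrite mul1r.
have [chi chiP] := Fp_faithful_char p.
have := atom_values_count chiP (Fp_two_neq0 p_prime p_odd) uJ Jopp rankB a1P a2P a3P.
cbv zeta; set N := #|[set _ | _]|; set v := #|{: 'M_(k + k, n)}|.
rewrite (card_Fp_subspace p_prime (span_Psi J)).
rewrite (card_Fp_subspace p_prime (span_LambdaPerp J)).
rewrite (card_Fp_subspace p_prime (span_LambdaPerp' J)) -!expnM -!expnD.
rewrite ![(\dim _ * _)%N]mulnC; set d := (_ + _ + _)%N.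
rewrite card_Fp // -(ler_int R) rmorphM rmorphXn rmorphB /= -!pmulrn => bound.
have p_gt0 := prime_gt0 p_prime.
have v0 : (v%:R : R) != 0.
  by rewrite pnatr_eq0 -lt0n; apply/card_gt0P; exists 0.
(* The relative deviation of the count N from its expected value v / p^d. *)
exists (((N * p ^ d)%:R - v%:R) / v%:R); split.
  apply: (@ler_powR_half R p d) => //.
    by rewrite !leq_add // mulnC leq_mul2r ?leq_dim_Psi ?leq_dim_LambdaPerp
      ?leq_dim_LambdaPerp' ?orbT.
  rewrite expr_div_n mulrAC ler_pdivrMr ?exprn_even_gt0 //.
  by rewrite -natrX -natrM -expnMn.
rewrite mulrBl divff // addrCA subrr addr0 natrM mulrA natrX.
rewrite [_ ^- _ * _]mulrCA mulVf ?expf_neq0 ?pnatr_eq0 -?lt0n // mulr1.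
rewrite /unif_prob; congr (_%:R / _%:R); last first.
  by rewrite card_prod /v !card_mx -expnD mulnDl.
(* Stacking X on D identifies the event with the set of Z counted by N. *)
pose glue (XD : 'M['F_p]_(k, n) * 'M['F_p]_(k, n)) := col_mx XD.1 XD.2.
have glueI : injective glue by move=> [X D] [X' D'] /eq_col_mx /= [-> ->].
rewrite -(card_imset _ glueI); apply: eq_card => Z; rewrite inE.
apply/imsetP/eqP => [[[X D]]|[e1 e2 e3]].
  rewrite unfold_in /= => /and3P[/forallP h1 /forallP h2 /forallP h3] ->.
  rewrite /atom_values /glue /= col_mxKu col_mxKd.
  by congr (_, _, _); apply/ffunP => i; rewrite !ffunE; apply/eqP.
exists (usubmx Z, dsubmx Z); last by rewrite /glue vsubmxK.
rewrite unfold_in /=; apply/and3P; split; apply/forallP => i; apply/eqP.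
- by move/ffunP/(_ i): e1; rewrite !ffunE.
- by move/ffunP/(_ i): e2; rewrite !ffunE.
- by move/ffunP/(_ i): e3; rewrite !ffunE.
Qed.
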